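(* Let $A=[A(i,j)]_{i,j=1}^N$ be an $N\times N$ matrix with entries in $\{0,1\}$, and let $\bar{A}$ be the $(N+3)\times(N+3)$ matrix with entries in $\{0,1\}$ defined by $$ \bar{A}= \begin{bmatrix} A(1,1) & \dots & A(1,N-1) & A(1,N) & 0 & 0 & 0 \\ \vdots & & \vdots & \vdots & \vdots & \vdots & \vdots \\ A(N-1,1)& \dots & A(N-1,N-1)& A(N-1,N)& 0 & 0 & 0 \\ 0 & \dots & 0 & 0 & 1 & 0 & 0 \\ A(N,1) & \dots & A(N,N-1) & A(N,N) & 0 & 1 & 0 \\ 0 & \dots & 0 & 0 & 1 & 1 & 1 \\ 0 & \dots & 0 & 0 & 0 & 1 & 1 \end{bmatrix}. $$ Then there exists a group isomorphism $\Phi: G(A)\to G(\bar{A})$ such that $\Phi(u_A)=u_{\bar{A}}$, and $\det(1-A)=-\det(1-\bar{A})$. Moreover, if $A$ is an irreducible non-permutation matrix, then so is $\bar{A}$.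
   Context: For an $n\times n$ matrix $M$ with entries in $\{0,1\}$, $G(M)$ denotes the abelian group $\mathbb{Z}^n/(1-M^t)\mathbb{Z}^n$, where $M^t$ is the transpose and $1$ the identity matrix, and $u_M\in G(M)$ denotes the class of the vector $(1,\dots,1)\in\mathbb{Z}^n$. An $n\times n$ matrix $M$ with entries in $\{0,1\}$ is irreducible if for all $i,j$ there is $k\ge 1$ with $M^k(i,j)>0$. In the displayed matrix $\bar A$, the rows $1,\dots,N-1$ are the rows $1,\dots,N-1$ of $A$ followed by three zeros; row $N$ has a single nonzero entry $1$ in column $N+1$; row $N+1$ is the $N$th row of $A$ followed by $(0,1,0)$; row $N+2$ has entries $1$ exactly in columns $N+1,N+2,N+3$; row $N+3$ has entries $1$ exactly in columns $N+2,N+3$. *)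

(* Defs.v *)
From HB Require Import structures.
From mathcomp Require Import all_boot all_order all_fingroup all_algebra.
From mathcomp Require Import boolp.

Set Implicit Arguments.
Unset Strict Implicit.
Unset Printing Implicit Defensive.

Import Order.TTheory GRing.Theory Num.Theory.
Local Open Scope ring_scope.

Definition zero_one_mx n (M : 'M[int]_n) : Prop :=
  forall i j, M i j = 0 \/ M i j = 1.

Definition irreducible_mx n (M : 'M[int]_n) : Prop :=
  forall i j, exists k : nat, (1 <= k)%N /\ 0 < (M ^+ k) i j.

(* The quotient construction of the library requires a boolean membership
   predicate, hence the use of asbool. *)
Definition relation_lattice n (M : 'M[int]_n) : 'cV[int]_n -> bool :=
  fun v => `[< exists w : 'cV[int]_n, v = (1%:M - M^T) *m w >].

Lemma relation_lattice_zmod_closed n (M : 'M[int]_n) :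
  zmod_closed (relation_lattice M).
Proof.
split; first by apply/asboolP; exists 0; rewrite mulmx0.
move=> _ _ /asboolP[v ->] /asboolP[w ->].
by apply/asboolP; exists (v - w); rewrite mulmxBr.
Qed.

HB.instance Definition _ n (M : 'M[int]_n) :=
  GRing.isZmodClosed.Build 'cV[int]_n (relation_lattice M)
    (relation_lattice_zmod_closed M).

Definition relation_subgroup n (M : 'M[int]_n) : zmodClosed 'cV[int]_n :=
  GRing.ZmodClosed.clone 'cV[int]_n (relation_lattice M) _.

Definition Ggroup n (M : 'M[int]_n) : zmodType :=
  Quotient.quot (relation_subgroup M).

Definition Gclass n (M : 'M[int]_n) (v : 'cV[int]_n) : Ggroup M :=
  \pi_(Quotient.quot (relation_subgroup M))%qT v.

Definition Gunit n (M : 'M[int]_n) : Ggroup M := Gclass M (const_mx 1).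

(* The N x N matrix A is taken with N = n.+1, so that its last row is the one
   of index ord_max. In the upper left block this row is replaced by zeros; the
   original one is moved to the top of the lower left block. *)
Definition bar_mx n (A : 'M[int]_n.+1) : 'M[int]_(n.+1 + 3) :=
  block_mx
    (\matrix_(i < n.+1, j < n.+1) if i == ord_max then 0 else A i j)
    (\matrix_(i < n.+1, j < 3) if (i == ord_max) && (j == 0) then 1 else 0)
    (\matrix_(i < 3, j < n.+1) if i == 0 then A ord_max j else 0)
    (\matrix_(i < 3, j < 3)
       nth 0 (nth [::] [:: [:: 0; 1; 0];
                           [:: 1; 1; 1];
                           [:: 0; 1; 1]] i) j).

Lemma zero_one_bar_mx n (A : 'M[int]_n.+1) :
  zero_one_mx A -> zero_one_mx (bar_mx A).
Proof.
move=> A01 i j; rewrite /bar_mx.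
case: (split_ordP i) => i' ->; case: (split_ordP j) => j' ->;
  rewrite ?block_mxEul ?block_mxEur ?block_mxEdl ?block_mxEdr mxE.
- by case: ifP => _; [left | exact: A01].
- by case: ifP => _; [right | left].
- by case: ifP => _; [exact: A01 | left].
- by case: i' => [[|[|[|?]]] ?] //; case: j' => [[|[|[|?]]] ?] //;
    rewrite /=; auto.
Qed.

(* Main.v *)
Require Import Defs.
From HB Require Import structures.
From mathcomp Require Import all_boot all_order all_fingroup all_algebra.
From mathcomp Require Import boolp.

Import Order.TTheory GRing.Theory Num.Theory.
Local Open Scope ring_scope.

(* Let W be 1 minus the lower right 3x3 block of bar A. It has determinant -1,
   and the Schur complement of W in 1 - bar A is exactly 1 - A; this gives the
   determinant formula, and v |-> (v, 0) induces the isomorphism of the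
   quotients. Its inverse sends the class of (v, u) to that of
   v + (u_1 - u_3) * (last row of A), hence the unit class to the unit class.
   In the graph of bar A, every edge of A leaving the last vertex is replaced
   by a path of length two through N+1, so connectivity is inherited from A,
   and all vertices communicate with N+1; row N+2 has three nonzero entries,
   so bar A is never a permutation matrix. *)

(** * Isomorphisms between quotients by relation lattices *)

Lemma Gclass_eq n (M : 'M[int]_n) (v w : 'cV[int]_n) :
  Gclass M v = Gclass M w <-> relation_lattice M (v - w).
Proof.
have E := @Quotient.idealrBE _ (relation_subgroup M) v w.
by split=> [/eqP h | h];
  [rewrite -[relation_lattice M _]/(v - w \in relation_subgroup M) E
  | apply/eqP; rewrite -E].
Qed.

Lemma Gclass_reprK n (M : 'M[int]_n) (x : Ggroup M) :
  Gclass M (generic_quotient.repr x) = x.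
Proof. exact: reprK. Qed.

Lemma GclassB n (M : 'M[int]_n) (v w : 'cV[int]_n) :
  Gclass M (v - w) = Gclass M v - Gclass M w.
Proof. exact: (raddfB \pi_(Quotient.quot (relation_subgroup M))%qT). Qed.

(** The backward half of the first hypothesis lets [f] descend to the quotients, its forward half
    makes the descended map injective, and the second hypothesis makes it surjective. *)
Lemma Ggroup_iso m n (M : 'M[int]_m) (M' : 'M[int]_n)
    (f : {additive 'cV[int]_m -> 'cV[int]_n}) :
    (forall v, relation_lattice M' (f v) <-> relation_lattice M v) ->
    (forall w, exists v, relation_lattice M' (w - f v)) ->
  exists Phi : {additive Ggroup M -> Ggroup M'},
    bijective Phi /\ forall v, Phi (Gclass M v) = Gclass M' (f v).
Proof.
move=> flat fsurj.
pose phi (x : Ggroup M) : Ggroup M' := Gclass M' (f (generic_quotient.repr x)).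
have phiE v : phi (Gclass M v) = Gclass M' (f v).
  by apply/Gclass_eq; rewrite -raddfB; apply/flat/Gclass_eq/Gclass_reprK.
have phiB : zmod_morphism phi.
  move=> x y; rewrite -[x]Gclass_reprK -[y]Gclass_reprK.
  by rewrite -GclassB !phiE raddfB GclassB.
pose Phi := GRing.isZmodMorphism.Build _ _ phi phiB.
pose PhiA : {additive Ggroup M -> Ggroup M'} := HB.pack phi Phi.
exists PhiA; split=> //.
have [g gP] := choice fsurj.
exists (fun y => Gclass M (g (generic_quotient.repr y))) => [x | y] /=.
  rewrite -[RHS]Gclass_reprK; apply/Gclass_eq/flat; rewrite raddfB.
  apply/Gclass_eq; rewrite -[RHS]/(phi x) -[RHS]Gclass_reprK.
  exact/esym/Gclass_eq/gP.
by rewrite phiE -[RHS]Gclass_reprK; apply/esym/Gclass_eq/gP.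
Qed.

(* A factorization
     1 - M' = [1 K; 0 1] * diag (1 - M, W) * [1 0; H 1]
   with W invertible over the integers makes 1 - M and 1 - M' stably
   equivalent; only the multiplied-out form is used. *)
Section Extension.

Variables (m p : nat) (M : 'M[int]_m) (M' : 'M[int]_(m + p)).
Variables (K : 'M[int]_(m, p)) (H : 'M[int]_(p, m)) (W : 'M[int]_p).
Hypothesis M'E : 1%:M - M' =
  block_mx (1%:M - M + K *m W *m H) (K *m W) (W *m H) W.

Lemma det_extension : \det (1%:M - M') = \det (1%:M - M) * \det W.
Proof.
have -> : 1%:M - M' =
    block_mx 1%:M K 0 1%:M *m block_mx (1%:M - M) 0 (W *m H) W.
  by rewrite M'E mulmx_block !mul1mx !mul0mx !add0r mulmxA.
by rewrite det_mulmx det_ublock det_lblock !det1 !mul1r.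
Qed.

(** With [y] for the lower block, the image vector is [(x + H^T y, y)], where [x] lies in the
    lattice of [M]; when [W] is invertible, [w2] can be chosen to give any [y]. *)
Lemma relation_map_extension (w1 : 'cV[int]_m) (w2 : 'cV[int]_p) :
  (1%:M - M'^T) *m col_mx w1 w2 =
    col_mx ((1%:M - M^T) *m w1 + H^T *m (W^T *m (K^T *m w1 + w2)))
           (W^T *m (K^T *m w1 + w2)).
Proof.
have trB q (X : 'M[int]_q) : 1%:M - X^T = (1%:M - X)^T.
  by rewrite linearB /= tr_scalar_mx.
rewrite trB M'E tr_block_mx mul_block_col linearD /= -trB !trmx_mul.
by rewrite !mulmxDl !mulmxDr !mulmxA addrA.
Qed.

Lemma relation_lattice_extension0 v :
  relation_lattice M' (col_mx v 0) <-> relation_lattice M v.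
Proof.
split=> /asboolP[w wE]; apply/asboolP.
  move: wE; rewrite -[w]vsubmxK relation_map_extension.
  by case/eq_col_mx=> -> <-; exists (usubmx w); rewrite mulmx0 addr0.
(* The lower component is chosen to make [K^T w1 + w2] vanish. *)
exists (col_mx w (- (K^T *m w))).
by rewrite relation_map_extension addrN !mulmx0 addr0 -wE.
Qed.

Lemma relation_lattice_extension1 (u : 'cV[int]_p) :
  W \in unitmx -> relation_lattice M' (col_mx (H^T *m u) u).
Proof.
move=> Wu; apply/asboolP; exists (col_mx 0 (invmx W^T *m u)).
by rewrite relation_map_extension !mulmx0 !add0r mulKVmx ?unitmx_tr.
Qed.

(** Modulo the lattice of [M'], [(v, u)] equals [(v - H^T u, 0)], so every class comes from some
    [(v, 0)]. *)
Lemma Ggroup_extension_iso : W \in unitmx ->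
  exists Phi : {additive Ggroup M -> Ggroup M'},
    bijective Phi /\
    forall v u, Phi (Gclass M (v - H^T *m u)) = Gclass M' (col_mx v u).
Proof.
move=> Wu.
pose f (v : 'cV[int]_m) : 'cV[int]_(m + p) := col_mx v 0.
have fB : zmod_morphism f.
  by move=> x y; rewrite /f opp_col_mx add_col_mx subr0.
pose F : {additive 'cV[int]_m -> 'cV[int]_(m + p)} :=
  HB.pack f (GRing.isZmodMorphism.Build _ _ f fB).
have latF v u : relation_lattice M' (col_mx v u - F (v - H^T *m u)).
  rewrite /= /f opp_col_mx add_col_mx subr0 subKr.
  exact: relation_lattice_extension1.
have [||Phi [Phib PhiE]] := @Ggroup_iso _ _ M M' F.
- exact: relation_lattice_extension0.
- by move=> w; exists (usubmx w - H^T *m dsubmx w); rewrite -{1}[w]vsubmxK.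
by exists Phi; split=> // v u; rewrite PhiE; apply/esym/Gclass_eq/latF.
Qed.

End Extension.

(** * The factorization of [1 - bar_mx A] *)

Section BarFactors.

Variables (n : nat) (A : 'M[int]_n.+1).

(* The first column of the inverse of the symmetric matrix bar_corner. *)
Definition bar_vec : 'cV[int]_3 := \col_(i < 3) nth 0 [:: 1; 0; -1] i.

(* 1 minus the lower right block of bar_mx. *)
Definition bar_corner : 'M[int]_3 :=
  \matrix_(i < 3, j < 3)
    nth 0 (nth [::] [:: [:: 1; -1; 0];
                        [:: -1; 0; -1];
                        [:: 0; -1; 0]] i) j.

Lemma bar_corner_vec : bar_corner *m bar_vec = delta_mx 0 0.
Proof.
by apply/matrixP=> i j; rewrite !mxE !big_ord_recr big_ord0 /= !mxE !ord1;
  case: i => [[|[|[|?]]] ?].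
Qed.

Lemma bar_vec_corner : bar_vec^T *m bar_corner = delta_mx 0 0.
Proof.
by apply/matrixP=> i j; rewrite !mxE !big_ord_recr big_ord0 /= !mxE !ord1;
  case: j => [[|[|[|?]]] ?].
Qed.

Lemma det_bar_corner : \det bar_corner = -1.
Proof.
do 3!rewrite ?(expand_det_row _ 0) ?big_ord_recr ?big_ord0 /= /cofactor.
by rewrite ?det_mx11 ?det_mx00 ?mxE.
Qed.

(** [K] and [H] are obtained by dividing the off-diagonal blocks of [1 - bar_mx A] by [bar_corner].
    The product [K W H] then restores the last row of [A], cancelling it in [1 - A]. *)
Lemma sub1_bar_mx :
  let K := - delta_mx ord_max 0 *m bar_vec^T in
  let H := - bar_vec *m row ord_max A in
  1%:M - bar_mx A =
    block_mx (1%:M - A + K *m bar_corner *m H) (K *m bar_corner)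
             (bar_corner *m H) bar_corner.
Proof.
move=> K H.
have KW : K *m bar_corner = - delta_mx ord_max 0.
  by rewrite /K -mulmxA bar_vec_corner mulNmx mul_delta_mx.
have WH : bar_corner *m H = - (delta_mx 0 0 *m row ord_max A).
  by rewrite /H mulNmx mulmxN mulmxA bar_corner_vec.
have KWH : K *m bar_corner *m H = delta_mx ord_max 0 *m row ord_max A.
  (* What remains is that the first entry of [bar_vec] is 1. *)
  rewrite KW /H !mulNmx mulmxN opprK mulmxA; congr (_ *m _).
  apply/matrixP=> i j; rewrite !mxE !big_ord_recr big_ord0 /= !mxE !ord1 /=.
  by rewrite !andbF andbT mulr1 !mul0r addr0 add0r addr0.
rewrite KWH KW WH (scalar_mx_block _ 3) /bar_mx opp_block_mx add_block_mx.
congr block_mx; apply/matrixP=> i j.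
- by rewrite !mxE big_ord1 !mxE eqxx andbT; case: (eqVneq i ord_max) => [->|_];
    rewrite ?subr0 ?mul1r ?subrK ?mul0r ?addr0.
- by rewrite !mxE add0r; case: ifP.
- by rewrite !mxE add0r big_ord1 !mxE eqxx andbT; case: eqP => _;
    rewrite ?mul1r ?mul0r.
- by rewrite !mxE; case: i => [[|[|[|?]]] ?] //;
    case: j => [[|[|[|?]]] ?].
Qed.

End BarFactors.

(** This makes [H^T] kill the all-ones vector, so that the unit class is preserved. *)
Lemma bar_vec_sum : bar_vec^T *m const_mx 1 = 0 :> 'cV[int]_1.
Proof.
by apply/matrixP=> i j; rewrite !mxE !big_ord_recr big_ord0 /= !mxE.
Qed.

(** * Walks and positive entries of matrix powers *)

Section Reachability.

Definition reachable {n} (M : 'M[int]_n) i j : Prop :=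
  exists k : nat, (1 <= k)%N /\ 0 < (M ^+ k) i j.

Lemma zero_one_mx_ge0 n (M : 'M[int]_n) :
  zero_one_mx M -> forall i j, 0 <= M i j.
Proof. by move=> M01 i j; case: (M01 i j) => ->. Qed.

Lemma reachable_edge n (M : 'M[int]_n) i j : 0 < M i j -> reachable M i j.
Proof. by exists 1%N. Qed.

Variables (n : nat) (M : 'M[int]_n).
Hypothesis M_ge0 : forall i j, 0 <= M i j.

Lemma expmx_ge0 k i j : 0 <= (M ^+ k) i j.
Proof.
elim: k i j => [|k IHk] i j; first by rewrite expr0 mxE; case: eqP.
by rewrite exprS mxE sumr_ge0 // => l _; rewrite mulr_ge0.
Qed.

(** Nonnegative terms cannot cancel, so a positive sum has a positive term: a walk of length [k + l]
    splits at its [k]-th step. *)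
Lemma expmxD_gt0 k l i j :
  0 < (M ^+ (k + l)) i j <-> exists h, 0 < (M ^+ k) i h /\ 0 < (M ^+ l) h j.
Proof.
have pos h : 0 <= (M ^+ k) i h * (M ^+ l) h j by rewrite mulr_ge0 ?expmx_ge0.
have -> : (M ^+ (k + l)) i j = \sum_h (M ^+ k) i h * (M ^+ l) h j.
  by rewrite exprD mxE.
split=> [/lt0r_neq0/eqP/psumr_neq0P[//|h]|[h [ih hj]]].
  have := expmx_ge0 k i h; have := expmx_ge0 l h j; rewrite !le_eqVlt.
  case/predU1P=> [<-|hj]; first by rewrite mulr0 ltxx.
  by case/predU1P=> [<-|ih]; [rewrite mul0r ltxx | exists h].
rewrite lt0r sumr_ge0 ?andbT // psumr_neq0 //.
by apply/hasP; exists h; rewrite ?mem_index_enum //= mulr_gt0.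
Qed.

Lemma reachable_trans i j l :
  reachable M i j -> reachable M j l -> reachable M i l.
Proof.
move=> [a [a0 ij]] [b [b0 jl]]; exists (a + b)%N; rewrite addn_gt0 a0.
by split=> //; apply/expmxD_gt0; exists j.
Qed.

(** An edge may go to a longer walk, as happens to the edges leaving the last vertex of [A]. *)
Lemma reachable_map m (N : 'M[int]_m) (f : 'I_n -> 'I_m) :
    (forall x y z, reachable N x y -> reachable N y z -> reachable N x z) ->
    (forall i j, 0 < M i j -> reachable N (f i) (f j)) ->
  forall i j, reachable M i j -> reachable N (f i) (f j).
Proof.
move=> Ntrans MN i j [k [k0]]; case: k k0 => // k _.
elim: k j => [|k IHk] j; first exact: MN.
rewrite -[k.+2]addn1 => /expmxD_gt0[h [ih hj]].
exact: Ntrans (IHk h ih) (MN _ _ hj).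
Qed.

Lemma irreducible_row_gt0 i : irreducible_mx M -> exists j, 0 < M i j.
Proof.
(* A closed walk of positive length at [i] has a first edge. *)
move=> /(_ i i)[k [k0]]; case: k k0 => // k _.
by rewrite -add1n => /expmxD_gt0[h [ih _]]; exists h.
Qed.

End Reachability.

Lemma bar_mx_irreducible n (A : 'M[int]_n.+1) :
  zero_one_mx A -> irreducible_mx A -> irreducible_mx (bar_mx A).
Proof.
move=> A01 Airr.
have A0 := zero_one_mx_ge0 _ _ A01.
have barA0 := zero_one_mx_ge0 _ _ (zero_one_bar_mx A01).
have trans := reachable_trans _ _ barA0.
pose e (i : 'I_n.+1) : 'I_(n.+1 + 3) := lshift 3 i.
pose f (i : 'I_3) : 'I_(n.+1 + 3) := rshift n.+1 i.
have edge_last : reachable (bar_mx A) (e ord_max) (f 0).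
  by apply: reachable_edge; rewrite /bar_mx block_mxEur mxE !eqxx.
have edge_row j : 0 < A ord_max j -> reachable (bar_mx A) (f 0) (e j).
  by move=> Aj; apply: reachable_edge; rewrite /bar_mx block_mxEdl mxE eqxx.
have lift_e i j : reachable A i j -> reachable (bar_mx A) (e i) (e j).
  apply: (reachable_map _ _ A0) i j => // i j Aij.
  have [iN | iN] := eqVneq i ord_max.
    by rewrite iN in Aij *; apply: trans edge_last (edge_row _ Aij).
  by apply: reachable_edge; rewrite /bar_mx block_mxEul mxE (negPf iN).
have f01 : reachable (bar_mx A) (f 0) (f 1).
  by apply: reachable_edge; rewrite /bar_mx block_mxEdr mxE.
have f10 : reachable (bar_mx A) (f 1) (f 0).
  by apply: reachable_edge; rewrite /bar_mx block_mxEdr mxE.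
have f12 : reachable (bar_mx A) (f 1) (f ord_max).
  by apply: reachable_edge; rewrite /bar_mx block_mxEdr mxE.
have f21 : reachable (bar_mx A) (f ord_max) (f 1).
  by apply: reachable_edge; rewrite /bar_mx block_mxEdr mxE.
have f0e : reachable (bar_mx A) (f 0) (e ord_max).
  have [j Aj] := irreducible_row_gt0 _ _ A0 ord_max Airr.
  exact: trans (edge_row _ Aj) (lift_e _ _ (Airr _ _)).
have hub x : reachable (bar_mx A) x (f 0) /\ reachable (bar_mx A) (f 0) x.
  case: (split_ordP x) => i ->.
    split; first exact: trans (lift_e _ _ (Airr i ord_max)) edge_last.
    exact: trans f0e (lift_e _ _ (Airr ord_max i)).
  have : i \in [:: 0; 1; ord_max] by case: i => [[|[|[|?]]] ?].
  rewrite !inE => /or3P[] /eqP->.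
  - by split; apply: trans f01 f10.
  - by split.
  - by split; [apply: trans f21 f10 | apply: trans f01 f12].
by move=> x y; apply: trans (proj1 (hub x)) (proj2 (hub y)).
Qed.

Lemma bar_mx_not_perm n (A : 'M[int]_n.+1) : ~~ is_perm_mx (bar_mx A).
Proof.
apply/is_perm_mxP=> -[s sE].
(* Row N+2 has a 1 in each of the last three columns, so [s] would take three values there. *)
have row1 (j : 'I_3) : s (rshift n.+1 1) = rshift n.+1 j.
  have: bar_mx A (rshift n.+1 1) (rshift n.+1 j) = 1.
    by rewrite /bar_mx block_mxEdr mxE; case: j => [[|[|[|?]]] ?].
  by rewrite sE !mxE; case: eqP.
by have := row1 0; rewrite (row1 1) => /rshift_inj.
Qed.

Theorem theorem3 (n : nat) (A : 'M[int]_n.+1) (A01 : zero_one_mx A) :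
  (exists Phi : {additive Ggroup A -> Ggroup (bar_mx A)},
      bijective Phi /\ Phi (Gunit A) = Gunit (bar_mx A)) /\
  \det (1%:M - A) = - \det (1%:M - bar_mx A) /\
  (irreducible_mx A /\ ~~ is_perm_mx A ->
     irreducible_mx (bar_mx A) /\ ~~ is_perm_mx (bar_mx A)).
Proof.
have barE := sub1_bar_mx n A.
split; [|split].
- have Wu : bar_corner \in unitmx by rewrite unitmxE det_bar_corner.
  have [Phi [Phib PhiE]] := Ggroup_extension_iso _ _ _ _ _ _ _ barE Wu.
  (* The formula for [Phi] is used with [v] and [u] both all ones. *)
  exists Phi; split=> //; rewrite /Gunit -col_mx_const -PhiE.
  rewrite trmx_mul linearN /= mulmxN mulNmx -mulmxA bar_vec_sum.
  by rewrite mulmx0 oppr0 subr0.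
- by rewrite (det_extension _ _ _ _ _ _ _ barE) det_bar_corner mulrN1 opprK.
- by case=> Airr _; split; [exact: bar_mx_irreducible | exact: bar_mx_not_perm].
Qed.
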